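(* Let $A,B,H,Q\in\mathbb{R}^{n\times n}$ with $A$ nonsingular, let $A=M-N$ with $M$ nonsingular, let $Q=Q_1-Q_2$ with $Q_1$ nonsingular, and let $\sigma>0$, $\omega>0$, $\theta>0$. Let $$a=\Vert M^{-1}N\Vert,\ c=\Vert M^{-1}BQ\Vert,\ d=\Vert Q_1^{-1}Q_2\Vert,\ \alpha=\Vert Q_1^{-1}\Vert,\ \beta=\Vert Q_1^{-1}H\Vert,$$ $$T=\begin{bmatrix} a & c\\ a(\theta\alpha+\beta)+\beta & c(\theta\alpha+\beta)+\theta d+|1-\theta|\end{bmatrix},$$ $$T_{\rm NSOR}=\begin{bmatrix}|1-\omega| & \omega\Vert A^{-1}B\Vert\\ \frac{\omega|1-\omega|}{\sigma}(\Vert A\Vert+\Vert B\Vert) & \frac{\omega^2}{\sigma}\Vert A^{-1}B\Vert\Vert B\Vert+\Vert I-\frac{\omega^2}{\sigma}B\Vert\end{bmatrix}.$$ Assume that $$\Big||1-\omega|\,\Big\Vert I-\frac{\omega^2}{\sigma}B\Big\Vert-\frac{\omega^2|1-\omega|}{\sigma}\Vert A^{-1}B\Vert\Vert A\Vert\Big|<1,$$ $$\frac{\omega^2}{\sigma}\Vert A^{-1}B\Vert\big(\Vert B\Vert+|1-\omega|\Vert A\Vert\big)<(1-|1-\omega|)\Big(1-\Big\Vert I-\frac{\omega^2}{\sigma}B\Big\Vert\Big),$$ and that $T$ is irreducible. If $$a<|1-\omega|,\quad c<\omega\Vert A^{-1}B\Vert,\quad \alpha c+d<1,$$ $$\left[\frac{\omega|1-\omega|}{\sigma}(\Vert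 A\Vert+\Vert B\Vert)\right](\alpha c+d-1)-\beta\big[(a+1)(d-1)+\alpha c\big]<a\alpha\left[\frac{\omega^2}{\sigma}\Vert A^{-1}B\Vert\Vert B\Vert+\Big\Vert I-\frac{\omega^2}{\sigma}B\Big\Vert-1\right],$$ and $\hat\mu<\theta<\min\{\hat\nu,\Delta\}$, where $$\hat\mu=\frac{\frac{\omega^2}{\sigma}\Vert A^{-1}B\Vert\Vert B\Vert+\Vert I-\frac{\omega^2}{\sigma}B\Vert-\beta c-1}{\alpha c+d-1},\quad \hat\nu=\frac{\frac{\omega^2}{\sigma}\Vert A^{-1}B\Vert\Vert B\Vert+\Vert I-\frac{\omega^2}{\sigma}B\Vert-\beta c+1}{1+\alpha c+d},$$ $$\Delta=\frac{\frac{\omega|1-\omega|}{\sigma}(\Vert A\Vert+\Vert B\Vert)-(a+1)\beta}{a\alpha},$$ then $\rho(T)<\rho(T_{\rm NSOR})<1$.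
   Context: $\Vert\cdot\Vert$ is the matrix 2-norm, $I$ the identity matrix, and $\rho(\cdot)$ the spectral radius. ''Irreducible'' is the usual notion for square (nonnegative) matrices. The matrices $T$ and $T_{\rm NSOR}$ are the $2\times2$ nonnegative matrices bounding the norms of successive differences of the iterates of the GRMS method (with parameters $M,N,Q,Q_1,Q_2,H,\theta$) and of the NSOR method (with parameters $\omega=\omega_{\rm NSOR}$, $\sigma=\sigma_{\rm NSOR}$), respectively. *)

(* Defs.v *)
From HB Require Import structures.
From mathcomp Require Import all_boot all_order all_algebra all_fingroup.
From mathcomp Require Import boolp classical_sets reals constructive_ereal.
From mathcomp Require Import complex.

Set Implicit Arguments.
Unset Strict Implicit.
Unset Printing Implicit Defensive.

Import Order.TTheory GRing.Theory Num.Theory.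

Local Open Scope classical_set_scope.
Local Open Scope ring_scope.

Definition vnorm2 (R : realType) (n : nat) (x : 'cV[R]_n) : R :=
  Num.sqrt (\sum_(i < n) x i 0 ^+ 2).

(* The norm that MathComp-Analysis puts on matrices is the entrywise maximum,
   so the operator norm induced by the Euclidean norm is defined here. *)
Definition mxnorm2 (R : realType) (m n : nat) (A : 'M[R]_(m, n)) : R :=
  sup [set vnorm2 (A *m x) | x in [set x : 'cV[R]_n | vnorm2 x <= 1]].

(* The eigenvalues of the real matrix A are taken in the complex field R[i];
   for n > 0 they form a nonempty finite set, and the supremum is a maximum. *)
Definition spectral_radius (R : realType) (n : nat) (A : 'M[R]_n) : R :=
  sup [set Normc.normc z |
       z in [set z : R[i] | eigenvalue (map_mx (real_complex R) A) z]].

(* P A P^T = [ *, *; 0, * ] for some permutation matrix P, with square diagonal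
   blocks of sizes k and n - k, both nonempty. *)
Definition reducible_mx (R : realType) (n : nat) (A : 'M[R]_n) : Prop :=
  exists (s : 'S_n) (k : nat), (0 < k < n)%N /\
    forall i j : 'I_n, (k <= i)%N -> (j < k)%N ->
      (perm_mx s *m A *m (perm_mx s)^T) i j = 0.

Definition irreducible_mx (R : realType) (n : nat) (A : 'M[R]_n) : Prop :=
  ~ reducible_mx A.

Definition mx22 (R : realType) (a11 a12 a21 a22 : R) : 'M[R]_2 :=
  \matrix_(i < 2, j < 2)
    if i == 0 then (if j == 0 then a11 else a12)
    else (if j == 0 then a21 else a22).

Definition T_GRMS (R : realType) (n : nat)
    (M N B H Q Q1 Q2 : 'M[R]_n) (theta : R) : 'M[R]_2 :=
  let a := mxnorm2 (invmx M *m N) in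
  let c := mxnorm2 (invmx M *m B *m Q) in
  let d := mxnorm2 (invmx Q1 *m Q2) in
  let alpha := mxnorm2 (invmx Q1) in
  let beta := mxnorm2 (invmx Q1 *m H) in
  mx22 a c
    (a * (theta * alpha + beta) + beta)
    (c * (theta * alpha + beta) + theta * d + `|1 - theta|).

Definition T_NSOR (R : realType) (n : nat)
    (A B : 'M[R]_n) (omega sigma : R) : 'M[R]_2 :=
  mx22
    `|1 - omega|
    (omega * mxnorm2 (invmx A *m B))
    (omega * `|1 - omega| / sigma * (mxnorm2 A + mxnorm2 B))
    (omega ^+ 2 / sigma * mxnorm2 (invmx A *m B) * mxnorm2 B
       + mxnorm2 (1%:M - (omega ^+ 2 / sigma) *: B)).

(* Main.v *)
Require Import Defs.
From HB Require Import structures.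
From mathcomp Require Import all_boot all_order all_algebra all_fingroup.
From mathcomp Require Import boolp classical_sets reals constructive_ereal.
From mathcomp Require Import complex ring lra.

(** Every entry of [T] is strictly smaller than the corresponding entry of
[T_NSOR].  For the (1,1) and (1,2) entries this is assumed.  For the (2,2) entry,
[|1 - theta|] is [1 - theta] or [theta - 1]; the first case turns the comparison
into [mu < theta], the second into [theta < nu].  For the (2,1) entry it is
[theta < Delta], including when [a * alpha = 0], because then a positive [theta] can
only lie below [Delta] if the numerator of [Delta] is positive.

The rest is Perron-Frobenius theory for a nonnegative 2x2 matrix
[[t11, t12; t21, t22]], which can be read off the equation
[(l - t11) (l - t22) = t12 t21].  It has a root [l] above both diagonal entries
([perron_root_exists]), and this root is the spectral radius
([spectral_radius_mx22]).  Since the left-hand side increases with [l] to the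
right of the diagonal entries, the root of a strictly dominated matrix is
strictly smaller ([perron_root_lt]), and the root is smaller than 1 when the
characteristic polynomial is positive at 1 and the determinant, the product of
the two eigenvalues, is smaller than 1 ([perron_root_lt1]).  The first two
assumptions of the theorem are these two conditions for [T_NSOR]. *)

Set Implicit Arguments.
Unset Strict Implicit.
Unset Printing Implicit Defensive.

Import Order.TTheory GRing.Theory Num.Theory.

Local Open Scope ring_scope.

(** * Norms and extended quotients *)

Lemma mxnorm2_ge0 (R : realType) (m n : nat) (A : 'M[R]_(m, n)) :
  0 <= mxnorm2 A.
Proof.
rewrite /mxnorm2; set E := (X in sup X).
case: (pselect (has_sup E)) => [E_sup|/sup_out -> //].
have [x Ex] := E_sup.1.
apply: le_trans (sup_upper_bound E_sup Ex).
by case: Ex => v _ <-; exact: sqrtr_ge0.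
Qed.

(** The case [y = 0] carries the content: [x / 0] is [+oo], [0] or [-oo] according
to the sign of [x], so only [x > 0] lets it exceed the positive number [t]. *)
Lemma ltr_mul_of_lte_div (R : realType) (t x y : R) :
  0 < t -> 0 <= y -> (t%:E < x%:E / y%:E)%E -> t * y < x.
Proof.
move=> t_gt0; rewrite le_eqVlt => /predU1P[<-|y_gt0].
  rewrite inve0 mulr0 mulry; have [//|x_lt0|<-] := ltgtP 0 x.
    by rewrite ltr0_sg // EFinN mulN1e.
  by rewrite sgr0 mul0e lte_fin ltNge (ltW t_gt0).
by rewrite inver gt_eqF // -EFinM lte_fin ltr_pdivlMr.
Qed.

(** * Perron roots of nonnegative matrices of order two *)

Lemma eigenvalue_mx22 (R : realType) (a b c d : R) (z : R[i]) :
  eigenvalue (map_mx (real_complex R) (mx22 a b c d)) z =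
  ((z - real_complex R a) * (z - real_complex R d) == real_complex R (b * c)).
Proof.
rewrite eigenvalue_root_char /root /char_poly (expand_det_row _ 0).
rewrite !big_ord_recl big_ord0 /cofactor !det_mx11 !mxE /= !hornerE /=.
rewrite rmorphM -[RHS]subr_eq0; congr (_ == _); ring.
Qed.

Lemma perron_root_exists (R : realType) (a b c d : R) :
  0 <= b -> 0 <= c ->
  exists l : R, [/\ a <= l, d <= l & (l - a) * (l - d) = b * c].
Proof.
move=> b_ge0 c_ge0; have bc_ge0 := mulr_ge0 b_ge0 c_ge0.
pose s := Num.sqrt ((a - d) ^+ 2 + 4 * (b * c)).
have D_ge0 : 0 <= (a - d) ^+ 2 + 4 * (b * c).
  by rewrite addr_ge0 ?sqr_ge0 // mulr_ge0.
have s2 : s ^+ 2 = (a - d) ^+ 2 + 4 * (b * c) by rewrite sqr_sqrtr.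
have : `|a - d| <= s by rewrite -sqrtr_sqr ler_sqrt // lerDl mulr_ge0.
rewrite ler_norml => /andP[? ?].
exists ((a + d + s) / 2); split; [lra|lra|].
have -> : ((a + d + s) / 2 - a) * ((a + d + s) / 2 - d)
          = (s ^+ 2 - (a - d) ^+ 2) / 4 by field.
by rewrite s2; field.
Qed.

Lemma ler_normcB_real (R : realType) (z : R[i]) (a : R) :
  0 <= a -> Normc.normc z - a <= Normc.normc (z - real_complex R a).
Proof.
move=> a_ge0; rewrite lerBlDr.
have := le_normcD (z - real_complex R a) (real_complex R a).
by rewrite subrK {3}/Normc.normc /= expr0n addr0 sqrtr_sqr ger0_norm.
Qed.

(** If [z] is an eigenvalue with [|z| > l], then [|z - a| > l - a] and
[|z - d| > l - d], so that [|z - a| |z - d|] exceeds [(l - a) (l - d) = b c]. *)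
Lemma spectral_radius_mx22 (R : realType) (a b c d l : R) :
  0 <= a -> 0 <= b -> 0 <= c -> 0 <= d ->
  a <= l -> d <= l -> (l - a) * (l - d) = b * c ->
  spectral_radius (mx22 a b c d) = l.
Proof.
move=> a_ge0 b_ge0 c_ge0 d_ge0 al dl l_root.
rewrite /spectral_radius; set E := (X in sup X).
have El : E l.
  exists (real_complex R l); last first.
    by rewrite /Normc.normc /= expr0n addr0 sqrtr_sqr ger0_norm // (le_trans a_ge0).
  by rewrite /= eigenvalue_mx22 -!rmorphB -rmorphM l_root.
have ubE : ubound E l.
  move=> _ [z /= + <-]; rewrite eigenvalue_mx22 => /eqP z_root.
  rewrite leNgt; apply/negP => lz.
  have /eqP : Normc.normc ((z - real_complex R a) * (z - real_complex R d))
              = b * c.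
    rewrite z_root /Normc.normc /= expr0n addr0 sqrtr_sqr.
    by rewrite ger0_norm // mulr_ge0.
  rewrite Normc.normcM -l_root gt_eqF // ltr_pM ?subr_ge0 //.
    by apply: lt_le_trans (ler_normcB_real z a_ge0); rewrite ltrD2r.
  by apply: lt_le_trans (ler_normcB_real z d_ge0); rewrite ltrD2r.
apply/eqP; rewrite eq_le; apply/andP; split.
  by apply: ge_sup => //; exists l.
by apply: ub_le_sup => //; exists l.
Qed.

Lemma perron_root_lt (R : realType) (a b c d a' b' c' d' l l' : R) :
  0 <= b -> 0 <= c -> a < a' -> b < b' -> c < c' -> d < d' ->
  a <= l -> d <= l -> (l - a) * (l - d) = b * c ->
  a' <= l' -> d' <= l' -> (l' - a') * (l' - d') = b' * c' ->
  l < l'.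
Proof.
move=> b_ge0 c_ge0 aa' bb' cc' dd' al dl l_root al' dl' l'_root.
rewrite ltNge; apply/negP => l'l.
have : b * c < b' * c' by exact: ltr_pM.
rewrite -l_root -l'_root ltNge => /negP; apply.
by apply: ler_pM; rewrite ?subr_ge0 // lerB // ltW.
Qed.

(** Positivity of the characteristic polynomial at 1 leaves two possibilities: 1
lies above both diagonal entries, or below both; in the second case both
eigenvalues exceed 1, and hence so does the determinant. *)
Lemma perron_root_lt1 (R : realType) (a b c d l : R) :
  0 <= b -> 0 <= c ->
  b * c < (1 - a) * (1 - d) -> a * d - b * c < 1 ->
  a <= l -> d <= l -> (l - a) * (l - d) = b * c ->
  l < 1.
Proof.
move=> b_ge0 c_ge0 char1 det1 al dl l_root.
have bc_ge0 := mulr_ge0 b_ge0 c_ge0.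
have a_lt1 : a < 1 by nra.
have d_lt1 : d < 1 by nra.
rewrite ltNge; apply/negP => l_ge1.
move: char1; rewrite -l_root ltNge => /negP; apply.
by apply: ler_pM; rewrite ?subr_ge0 ?(ltW a_lt1) ?(ltW d_lt1) // lerB.
Qed.

Lemma spectral_radius_mx22_lt (R : realType) (a b c d a' b' c' d' : R) :
  0 <= a -> 0 <= b -> 0 <= c -> 0 <= d ->
  a < a' -> b < b' -> c < c' -> d < d' ->
  spectral_radius (mx22 a b c d) < spectral_radius (mx22 a' b' c' d').
Proof.
move=> a0 b0 c0 d0 aa' bb' cc' dd'.
have a'0 := le_trans a0 (ltW aa'); have b'0 := le_trans b0 (ltW bb').
have c'0 := le_trans c0 (ltW cc'); have d'0 := le_trans d0 (ltW dd').
have [l [al dl lE]] := perron_root_exists a d b0 c0.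
have [l' [al' dl' lE']] := perron_root_exists a' d' b'0 c'0.
rewrite (spectral_radius_mx22 a0 b0 c0 d0 al dl lE).
rewrite (spectral_radius_mx22 a'0 b'0 c'0 d'0 al' dl' lE').
exact: (perron_root_lt b0 c0 aa' bb' cc' dd' al dl lE al' dl' lE').
Qed.

Lemma spectral_radius_mx22_lt1 (R : realType) (a b c d : R) :
  0 <= a -> 0 <= b -> 0 <= c -> 0 <= d ->
  b * c < (1 - a) * (1 - d) -> a * d - b * c < 1 ->
  spectral_radius (mx22 a b c d) < 1.
Proof.
move=> a0 b0 c0 d0 char1 det1.
have [l [al dl lE]] := perron_root_exists a d b0 c0.
rewrite (spectral_radius_mx22 a0 b0 c0 d0 al dl lE).
exact: (perron_root_lt1 b0 c0 char1 det1 al dl lE).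
Qed.

(** * Comparison of the two iteration matrices *)

(* Delta is an extended real: its denominator a * alpha vanishes when a = 0,
   and x%:E / 0 = +oo for x > 0, so that the upper bound Delta is then void. *)
Theorem theorem4 (R : realType) (n : nat) (hn : (0 < n)%N)
    (A B H Q M N Q1 Q2 : 'M[R]_n) (sigma omega theta : R)
    (A_unit : A \in unitmx)
    (A_split : A = M - N) (M_unit : M \in unitmx)
    (Q_split : Q = Q1 - Q2) (Q1_unit : Q1 \in unitmx)
    (sigma_gt0 : 0 < sigma) (omega_gt0 : 0 < omega) (theta_gt0 : 0 < theta) :
  let a := mxnorm2 (invmx M *m N) in
  let c := mxnorm2 (invmx M *m B *m Q) in
  let d := mxnorm2 (invmx Q1 *m Q2) in
  let alpha := mxnorm2 (invmx Q1) in
  let beta := mxnorm2 (invmx Q1 *m H) in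
  let nA := mxnorm2 A in
  let nB := mxnorm2 B in
  let nAB := mxnorm2 (invmx A *m B) in
  let nIB := mxnorm2 (1%:M - (omega ^+ 2 / sigma) *: B) in
  let T := T_GRMS M N B H Q Q1 Q2 theta in
  let TN := T_NSOR A B omega sigma in
  let mu := (omega ^+ 2 / sigma * nAB * nB + nIB - beta * c - 1)
              / (alpha * c + d - 1) in
  let nu := (omega ^+ 2 / sigma * nAB * nB + nIB - beta * c + 1)
              / (1 + alpha * c + d) in
  let Delta : \bar R :=
    ((omega * `|1 - omega| / sigma * (nA + nB) - (a + 1) * beta)%:E
       / (a * alpha)%:E)%E in
  `| `|1 - omega| * nIB - omega ^+ 2 * `|1 - omega| / sigma * nAB * nA | < 1 ->
  omega ^+ 2 / sigma * nAB * (nB + `|1 - omega| * nA)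
    < (1 - `|1 - omega|) * (1 - nIB) ->
  irreducible_mx T ->
  a < `|1 - omega| ->
  c < omega * nAB ->
  alpha * c + d < 1 ->
  (omega * `|1 - omega| / sigma * (nA + nB)) * (alpha * c + d - 1)
    - beta * ((a + 1) * (d - 1) + alpha * c)
    < a * alpha * (omega ^+ 2 / sigma * nAB * nB + nIB - 1) ->
  mu < theta ->
  (theta%:E < Order.min nu%:E Delta)%E ->
  spectral_radius T < spectral_radius TN /\ spectral_radius TN < 1.
Proof.
move=> a c d alpha beta nA nB nAB nIB T TN mu nu Delta.
have a0 : 0 <= a by exact: mxnorm2_ge0.
have c0 : 0 <= c by exact: mxnorm2_ge0.
have d0 : 0 <= d by exact: mxnorm2_ge0.
have alpha0 : 0 <= alpha by exact: mxnorm2_ge0.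
have beta0 : 0 <= beta by exact: mxnorm2_ge0.
have nA0 : 0 <= nA by exact: mxnorm2_ge0.
have nB0 : 0 <= nB by exact: mxnorm2_ge0.
have nAB0 : 0 <= nAB by exact: mxnorm2_ge0.
have nIB0 : 0 <= nIB by exact: mxnorm2_ge0.
move=> det_TN char_TN _ a_lt c_lt ac_d _ mu_lt; rewrite lt_min => /andP[].
rewrite lte_fin => lt_nu lt_Delta.
have theta0 := ltW theta_gt0; have omega0 := ltW omega_gt0.
have t21_lt : a * (theta * alpha + beta) + beta
              < omega * `|1 - omega| / sigma * (nA + nB).
  have /= := ltr_mul_of_lte_div theta_gt0 (mulr_ge0 a0 alpha0) lt_Delta.
  by lra.
have t22_lt : c * (theta * alpha + beta) + theta * d + `|1 - theta|
              < omega ^+ 2 / sigma * nAB * nB + nIB.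
  have ac0 := mulr_ge0 alpha0 c0.
  (* the denominator of mu is negative, that of nu is positive *)
  move: mu_lt; rewrite ltr_ndivrMr; last by rewrite subr_lt0.
  move: lt_nu; rewrite ltr_pdivlMr; last by lra.
  by case: (ger0P (1 - theta)) => _; lra.
have T_ge0 : 0 <= a * (theta * alpha + beta) + beta
    /\ 0 <= c * (theta * alpha + beta) + theta * d + `|1 - theta|.
  by split; rewrite !(addr_ge0, mulr_ge0).
have [t21_ge0 t22_ge0] := T_ge0.
split; first exact: spectral_radius_mx22_lt.
apply: spectral_radius_mx22_lt1.
- exact: normr_ge0.
- by rewrite mulr_ge0.
- exact: le_trans t21_ge0 (ltW t21_lt).
- exact: le_trans t22_ge0 (ltW t22_lt).
- rewrite -/nA -/nB -/nAB -/nIB -subr_gt0.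
  (* the terms in |1 - omega| * nAB * nB cancel *)
  have -> : (1 - `|1 - omega|) * (1 - (omega ^+ 2 / sigma * nAB * nB + nIB))
      - omega * nAB * (omega * `|1 - omega| / sigma * (nA + nB))
    = (1 - `|1 - omega|) * (1 - nIB)
      - omega ^+ 2 / sigma * nAB * (nB + `|1 - omega| * nA) by ring.
  by rewrite subr_gt0.
- rewrite -/nA -/nB -/nAB -/nIB; apply: le_lt_trans det_TN.
  apply: le_trans (ler_norm _); rewrite le_eqVlt; apply/orP; left; apply/eqP.
  by ring.
Qed.
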